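(* Let $d\ge 1$ and let $\alpha \in \mathbb{R}^d$ be an irrational vector. Let $S$ and $S'$ be two Riemann measurable sets in $\mathbb{R}^d$ which are bounded remainder sets (with respect to $\alpha$) of the same measure. Then $S$ and $S'$ are equidecomposable, by Riemann measurable pieces, using translations by vectors belonging to $\mathbb{Z}\alpha + \mathbb{Z}^d$ only.
   Context: A vector $\alpha = (\alpha_1,\dots,\alpha_d) \in \mathbb{R}^d$ is called irrational if $1, \alpha_1, \ldots, \alpha_d$ are linearly independent over $\mathbb{Q}$. We write $\mathbb{Z}\alpha+\mathbb{Z}^d = \{ n\alpha + m : n \in \mathbb{Z}, m \in \mathbb{Z}^d\}$ and $\mathbb{T}^d = \mathbb{R}^d/\mathbb{Z}^d$. For a bounded measurable set $S \subset \mathbb{R}^d$ let $\chi_S(x) = \sum_{k \in \mathbb{Z}^d} \mathbf{1}_S(x+k)$, a $\mathbb{Z}^d$-periodic function regarded as a function on $\mathbb{T}^d$. A bounded measurable set $S \subset \mathbb{R}^d$ is a bounded remainder set (BRS) with respect to $\alpha$ if there is a constant $C = C(S,\alpha)$ such that for every $n \geq 1$ and almost every $x \in \mathbb{T}^d$, $\left| \sum_{k=0}^{n-1} \chi_S(x+k\alpha) - n \operatorname{mes} S \right| \leq C$, where $\operatorname{mes}$ is Lebesgue measure. A bounded set in $\mathbb{R}^d$ is Riemann measurable if its boundary has Lebesgue measure zero. Two Riemann measurable sets $S, S'$ are equidecomposable by Riemann measurable pieces using translations by vectors in $\mathbb{Z}\alpha+\mathbb{Z}^d$ if $S$ can be partitioned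 into finitely many Riemann measurable subsets $S_1,\dots,S_N$ and there are vectors $\gamma_1,\dots,\gamma_N \in \mathbb{Z}\alpha+\mathbb{Z}^d$ such that the sets $S_j+\gamma_j$ form, up to measure zero, a partition of $S'$. *)

(* Defs.v *)
From HB Require Import structures.
From mathcomp Require Import all_boot all_order all_algebra.
From mathcomp Require Import all_classical all_reals all_analysis.

Set Implicit Arguments.
Unset Strict Implicit.
Unset Printing Implicit Defensive.

Import Order.TTheory GRing.Theory Num.Theory.
Import numFieldNormedType.Exports.

Local Open Scope classical_set_scope.
Local Open Scope ring_scope.

(* Points of R^d are row vectors 'rV[R]_d, with their library topology and
   (sup) norm.  The library only has Lebesgue measure on the line, so the
   d-dimensional one is built here: the outer measure given by countable
   coverings by boxes, restricted to its Caratheodory-measurable sets. *)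

Section lebesgue.
Context {R : realType} {d : nat}.
Implicit Types (A : set 'rV[R]_d) (I : 'rV[R]_d * 'rV[R]_d).

Definition box I : set 'rV[R]_d :=
  [set x | forall i, I.1 ord0 i <= x ord0 i < I.2 ord0 i].

Definition box_vol I : \bar R :=
  (\prod_i Num.max 0 (I.2 ord0 i - I.1 ord0 i))%:E.

Definition box_cover A : set (set ('rV[R]_d * 'rV[R]_d)) :=
  [set F | countable F /\ A `<=` \bigcup_(I in F) box I].

Definition mes A : \bar R :=
  ereal_inf [set (\esum_(I in F) box_vol I)%E | F in box_cover A].

Lemma box_vol_ge0 I : (0 <= box_vol I)%E.
Proof. by rewrite lee_fin; apply: prodr_ge0 => i _; rewrite le_max lexx. Qed.

Lemma mes_ge0 A : (0 <= mes A)%E.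
Proof.
apply: le_ereal_inf_tmp => _ [F _ <-].
by apply: esum_ge0 => I _; exact: box_vol_ge0.
Qed.

Lemma mes_set0 : mes set0 = 0%E.
Proof.
apply/eqP; rewrite eq_le mes_ge0 andbT; apply: ereal_inf_lbound.
by exists set0; [split => // | rewrite esum_set0].
Qed.

Lemma le_mes : {homo mes : A B / A `<=` B >-> (A <= B)%E}.
Proof.
move=> A B AB; apply/ereal_inf_le_tmp => _ [F [cF BF] <-].
by exists F => //; split => //; exact: subset_trans BF.
Qed.

Lemma esum_bigcup_le (F : (set ('rV[R]_d * 'rV[R]_d))^nat) :
  (\esum_(I in \bigcup_n F n) box_vol I
     <= \sum_(n <oo) \esum_(I in F n) box_vol I)%E.
Proof.
rewrite seqDU_bigcup_eq.
rewrite (esum_bigcupT _ _ (trivIset_seqDU F) box_vol_ge0).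
rewrite nneseries_esumT; last first.
  by move=> n; apply: esum_ge0 => I _; exact: box_vol_ge0.
apply: le_esum => n _.
rewrite [leLHS]esum_mkcond [leRHS]esum_mkcond; apply: le_esum => I _.
case: ifPn => [/set_mem/(@subset_seqDU _ F n) FI|_]; first by rewrite mem_set.
by case: ifPn => // _; exact: box_vol_ge0.
Qed.

Lemma mes_sigma_subadditive : sigma_subadditive mes.
Proof.
move=> A; have [[i ioo]|] := pselect (exists i, mes (A i) = +oo%E).
  rewrite (eseries_pinfty _ _ ioo) ?leey// => n _.
  by rewrite -ltNye (lt_le_trans _ (mes_ge0 _)).
rewrite -forallNE => Aoo.
apply/lee_addgt0Pr => _/posnumP[e].
rewrite (le_trans _ (epsilon_trick _ _ _))//; last first.
  by move=> n; exact: mes_ge0.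
pose P n F := box_cover (A n) F /\
  (\esum_(I in F) box_vol I <= mes (A n) + (e%:num / (2 ^ n.+1)%:R)%:E)%E.
have [G PG] : {G & forall n, P n (G n)}.
  apply: (@choice _ _ P) => n.
  have en1 : 0 < e%:num / (2 ^ n.+1)%:R by [].
  have fin : mes (A n) \is a fin_num.
    by rewrite ge0_fin_numE ?mes_ge0// ltey; apply/eqP/Aoo.
  have [_ [F cF <-] xS] := lb_ereal_inf_adherent en1 fin.
  by exists F; split => //; exact: ltW.
apply: (@le_trans _ _ (\esum_(I in \bigcup_n G n) box_vol I)%E).
  apply: ereal_inf_lbound; exists (\bigcup_n G n) => //; split.
    by apply: bigcup_countable => // n _; exact: (PG n).1.1.
  move=> x [n _ Anx]; have [I GnI Ix] := (PG n).1.2 x Anx.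
  by exists I => //; exists n.
apply: (le_trans (esum_bigcup_le _)).
apply: lee_nneseries => n _; last exact: (PG n).2.
by move=> _; apply: esum_ge0 => I _; exact: box_vol_ge0.
Qed.

HB.instance Definition _ := isOuterMeasure.Build R 'rV[R]_d mes
  mes_set0 mes_ge0 le_mes mes_sigma_subadditive.

End lebesgue.

(* R^d with the Lebesgue sigma-algebra, and [mes] as a (complete) measure on
   it. *)
Section lebesgue_sigma_algebra.
Context (R : realType) (d : nat).

Let mes_outer : {outer_measure set 'rV[R]_d -> \bar R} := @mes R d.

Definition lebesgue_rV_type : Type := caratheodory_type (@mes R d).

HB.instance Definition _ :=
  Measurable.copy lebesgue_rV_type (caratheodory_type mes_outer).

Definition lebesgue_rV : set lebesgue_rV_type -> \bar R := @mes R d.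

HB.instance Definition _ :=
  isMeasure.Build _ lebesgue_rV_type R lebesgue_rV
    (@caratheodory_measure0 _ _ mes_outer)
    (@caratheodory_measure_ge0 _ _ mes_outer)
    (@caratheodory_measure_sigma_additive _ _ mes_outer).

End lebesgue_sigma_algebra.

Definition lebesgue_measurable (R : realType) (d : nat) (S : set 'rV[R]_d) :=
  measurable (S : set (lebesgue_rV_type R d)).

Definition boundary (T : topologicalType) (A : set T) : set T :=
  closure A `\` interior A.

Definition riemann_measurable (R : realType) (d : nat) (S : set 'rV[R]_d) :=
  bounded_set S /\ mes (boundary S) = 0%E.

Definition irrational_vec (R : realType) (d : nat) (alpha : 'rV[R]_d) :=
  forall (q0 : rat) (q : 'I_d -> rat),
    ratr q0 * 1 + \sum_i ratr (q i) * alpha ord0 i = 0 ->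
    q0 = 0 /\ forall i, q i = 0.

Definition Zvec (R : realType) (d : nat) (m : 'rV[int]_d) : 'rV[R]_d :=
  map_mx intr m.

Definition Zalpha_Zd (R : realType) (d : nat) (alpha : 'rV[R]_d) :
    set 'rV[R]_d :=
  [set v | exists (n : int) (m : 'rV[int]_d), v = n%:~R *: alpha + Zvec R m].

(* [\sum_(k \in setT)] is the finitely supported sum; the support is finite at
   every x when S is bounded, the only case in which [chi] is used. *)
Definition chi (R : realType) (d : nat) (S : set 'rV[R]_d) (x : 'rV[R]_d) : R :=
  \sum_(k \in [set: 'rV[int]_d]) (\1_S (x + Zvec R k) : R).

(* The Birkhoff sums of [chi S] are Z^d-periodic, and a subset of R^d / Z^d is
   null iff its preimage in R^d is, so "almost every x in the torus" is
   expressed on R^d. *)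
Definition bounded_remainder_set (R : realType) (d : nat) (alpha : 'rV[R]_d)
    (S : set 'rV[R]_d) :=
  [/\ bounded_set S, lebesgue_measurable S &
    exists C : R, forall n : nat, (1 <= n)%N ->
      {ae @lebesgue_rV R d, forall x : 'rV[R]_d,
        `| (\sum_(0 <= k < n) chi S (x + k%:R *: alpha))
           - n%:R * fine (mes S) | <= C}].

Definition translate (R : realType) (d : nat) (v : 'rV[R]_d)
    (A : set 'rV[R]_d) : set 'rV[R]_d :=
  [set x + v | x in A].

(* The pieces partition S exactly; their translates partition S' only up to
   null sets, both in disjointness and in covering. *)
Definition riemann_equidecomposable (R : realType) (d : nat)
    (G S S' : set 'rV[R]_d) :=
  exists (N : nat) (P : 'I_N -> set 'rV[R]_d) (gamma : 'I_N -> 'rV[R]_d),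
    [/\ forall j, riemann_measurable (P j),
        \bigcup_j P j = S,
        trivIset setT P,
        forall j, G (gamma j) &
        [/\ forall i j, i != j ->
             mes (translate (gamma i) (P i) `&` translate (gamma j) (P j)) = 0%E,
            mes ((\bigcup_j translate (gamma j) (P j)) `\` S') = 0%E &
            mes (S' `\` \bigcup_j translate (gamma j) (P j)) = 0%E]].

(* Main.v *)
Require Import Defs.
From mathcomp Require Import all_boot all_order all_algebra finmap complex.
From mathcomp Require Import all_classical all_reals all_analysis.
From mathcomp Require Import ring lra zify.

Set Implicit Arguments.
Unset Strict Implicit.
Unset Printing Implicit Defensive.

Import Order.TTheory GRing.Theory Num.Theory.
Import numFieldNormedType.Exports.
Import ComplexField.Normc.

Local Open Scope classical_set_scope.
Local Open Scope ring_scope.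

(** Let T be the rotation by alpha. Along an orbit x, T x, T^2 x, ... think of
    the points of S (counted over each torus point with multiplicity, chi S) as
    customers who arrive, and of the points of S' as services on offer. The
    excess of arrivals over services is bounded, uniformly in time, because S
    and S' are bounded remainder sets of the same measure. Serving the customers
    first come, first served sends each s in S to a point s + n alpha + m of S'.
    Three things have to be seen: that the length of the queue is a well defined
    bounded function, that waiting times are bounded, and that all of this
    depends on s only through finitely many of the questions whether a translate
    of s lies in S or in S'.

    Let G be the invariant set of the points whose Z alpha + Z^d orbit avoids the
    boundaries of S and S' and the exceptional null sets of the remainder
    estimates. Its complement is null, because null sets are stable under
    countable unions and translations. Near a point of G, any finite number of
    the questions above keep their answers.

    Queue length. The queue at x must be the largest deficit that the future
    holds, the maximum of - excess n x over all n. The key step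
    ([queue_exists]) is that a window of fixed length suffices. Let D be the
    largest oscillation excess n1 x - excess n2 x over all x in G and all times,
    and let it be attained at x1. It is attained at the same two times on a whole
    neighbourhood of x1, which every orbit enters within a bounded time since the
    rotation is minimal ([hitting_time]). So every orbit shows the oscillation D
    within one fixed window, and since no orbit in G shows more, the extremes
    over the window are the extremes over all times. The window maximum
    therefore obeys the queue equation ([queue_balance]), is at most D, and is
    locally constant on G.

    Matching. List the points of S met by an orbit by time and, at equal times,
    by an order of Z^d that is invariant under translation; list S' in the same
    way. Each list is a bijection with an interval of integers
    ([visit_index_inj], [visit_index_surj]), and by the queue equation serving in
    order of arrival is the equality of two such indices. This gives a bijection
    of the points of S in G with those of S' in G ([served_exists],
    [served_uniq], [served_inj], [served_surj]). If S' has interior points, its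
    visits have bounded gaps, so with a bounded queue the waiting times are
    bounded, and only finitely many displacements n alpha + m occur. The pieces
    are the sets of the points of S with a given displacement; their boundaries
    lie outside G. If S' has no interior point it is part of its boundary, so S
    and S' are both null.

    Minimality is Kronecker's theorem, proved here with trigonometric
    polynomials that peak at the lattice ([central_coef_le_peak]). *)

(** * The unit circle *)

Section unit_circle.
Context {R : realType}.
Local Open Scope complex_scope.
Implicit Types (t r : R) (z w : R[i]).

(** The character exp(2 pi i t) of R/Z. *)
Definition circle_exp t : R[i] := cos (pi *+ 2 * t) +i* sin (pi *+ 2 * t).

Lemma circle_expD s t : circle_exp (s + t) = circle_exp s * circle_exp t.
Proof.
by apply/eqP; rewrite eq_complex /= mulrDr cosD sinD eqxx /= addrC mulrC
  [X in _ + X]mulrC (mulrC (cos _)) eqxx.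
Qed.

Lemma normc_circle_exp t : normc (circle_exp t) = 1.
Proof. by rewrite /= cos2Dsin2 sqrtr1. Qed.

Lemma circle_exp0 : circle_exp 0 = 1.
Proof. by rewrite /circle_exp mulr0 cos0 sin0. Qed.

Lemma circle_exp_neq0 t : circle_exp t != 0.
Proof.
apply: contraTneq (oner_neq0 R) => t0.
by rewrite -(normc_circle_exp t) t0 normc0 eqxx.
Qed.

Lemma circle_expN t : circle_exp (- t) = (circle_exp t)^-1.
Proof.
apply: (mulfI (circle_exp_neq0 t)).
by rewrite -circle_expD subrr circle_exp0 divff // circle_exp_neq0.
Qed.

Lemma circle_expMn t n : circle_exp (n%:R * t) = circle_exp t ^+ n.
Proof.
elim: n => [|n IH]; first by rewrite mul0r circle_exp0.
by rewrite exprS -IH -circle_expD mulrSr mulrDl mul1r addrC.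
Qed.

Lemma circle_exp_sum (I : finType) (F : I -> R) :
  circle_exp (\sum_i F i) = \prod_i circle_exp (F i).
Proof. exact: (big_morph _ circle_expD circle_exp0). Qed.

Lemma circle_exp_int t (n : int) : circle_exp (t + n%:~R) = circle_exp t.
Proof.
have nat_case s (k : nat) : circle_exp (s + k%:R) = circle_exp s.
  rewrite /circle_exp mulrDr mulr_natr.
  by rewrite (periodicn (@cosD2pi R)) (periodicn (@sinD2pi R)).
case: n => k; first exact: nat_case.
by rewrite NegzE mulrNz -[in RHS](subrK (k.+1%:R) t) nat_case.
Qed.

Lemma near_int t : exists n : int, `|t - n%:~R| <= 2^-1.
Proof.
exists (Num.floor (t + 2^-1)).
have /andP[] := floor_itv (t + 2^-1); rewrite rmorphD /= => h1 h2.
by rewrite ler_norml; apply/andP; split; lra.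
Qed.

Lemma pi2_itv t : 0 <= t <= 2^-1 -> pi *+ 2 * t \in `[0, (pi : R)].
Proof.
move=> /andP[t0 t1]; have pi0 := pi_ge0 R; rewrite in_itv /=.
by apply/andP; split; rewrite -mulr_natr; nra.
Qed.

Lemma cos_pi2_lt1 r : 0 < r <= 2^-1 -> cos (pi *+ 2 * r) < 1.
Proof.
move=> /andP[r0 r1]; have pi0 := pi_gt0 R.
rewrite -cos0 -(mulr0 (pi *+ 2)) ltr_cos ?pi2_itv //; try lra.
by rewrite ltr_pM2l // mulrn_wgt0.
Qed.

Lemma circle_exp_eq1 t : circle_exp t = 1 -> exists n : int, t = n%:~R.
Proof.
have [n tn] := near_int t => t1; exists n; apply/eqP; rewrite -subr_eq0.
rewrite -normr_eq0; apply: contraT => u0.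
have : cos (pi *+ 2 * `|t - n%:~R|) = 1.
  have : circle_exp (t - n%:~R) = 1 by rewrite -mulrNz circle_exp_int.
  move=> /(congr1 (@complex.Re R))/=; rewrite -cos_norm normrM.
  by rewrite (ger0_norm (_ : 0 <= pi *+ 2)) // mulrn_wge0// pi_ge0.
by move=> c1; have := cos_pi2_lt1 (r := `|t - n%:~R|);
  rewrite c1 ltxx lt0r u0 normr_ge0 tn => /(_ isT).
Qed.

Lemma normc_sqr z : normc z ^+ 2 = complex.Re z ^+ 2 + complex.Im z ^+ 2.
Proof. by case: z => a b /=; rewrite sqr_sqrtr // addr_ge0 // sqr_ge0. Qed.

Lemma normc_ge0 z : 0 <= normc z.
Proof. by case: z => a b /=; exact: sqrtr_ge0. Qed.

Lemma normc_1D_circle_exp t :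
  normc (1 + circle_exp t) ^+ 2 = 2 + 2 * cos (pi *+ 2 * t).
Proof.
rewrite normc_sqr /= add0r -[LHS]/((1 + cos _) ^+ 2 + sin _ ^+ 2).
by rewrite sin2cos2; ring.
Qed.

Lemma normc_1D_circle_exp_le4 t : normc (1 + circle_exp t) ^+ 2 <= 4.
Proof. rewrite normc_1D_circle_exp; have := cos_le1 (pi *+ 2 * t); lra. Qed.

(** Uniform decay away from the integers: this is what makes a high power of
    |1 + exp(2 pi i t)| concentrate at the integers. *)
Lemma normc_1D_circle_exp_far r : 0 < r -> exists2 q : R, 0 <= q < 1 &
  forall t, (forall n : int, r <= `|t - n%:~R|) ->
    normc (1 + circle_exp t) ^+ 2 <= 4 * q.
Proof.
move=> r0; pose s := Num.min r 2^-1.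
have s0 : 0 < s <= 2^-1 by rewrite lt_min r0 invr_gt0 ltr0n ge_min lexx orbT.
exists ((1 + cos (pi *+ 2 * s)) / 2).
  by have := cos_pi2_lt1 s0; have := cos_geN1 (pi *+ 2 * s); lra.
move=> t far; have [n tn] := near_int t.
have -> : circle_exp t = circle_exp (t - n%:~R) by rewrite -mulrNz circle_exp_int.
have sn : s <= `|t - n%:~R| by rewrite ge_min far.
rewrite normc_1D_circle_exp -cos_norm normrM (ger0_norm (_ : 0 <= pi *+ 2)).
  suff : cos (pi *+ 2 * `|t - n%:~R|) <= cos (pi *+ 2 * s) by lra.
  rewrite leNgt ltr_cos ?pi2_itv ?normr_ge0//; last by case/andP: s0 => /ltW -> ->.
  by rewrite -leNgt ler_wpM2l// mulrn_wge0// pi_ge0.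
by rewrite mulrn_wge0// pi_ge0.
Qed.

Lemma normc_prod (I : finType) (F : I -> R[i]) :
  normc (\prod_i F i) = \prod_i normc (F i).
Proof. exact: (big_morph _ (@normcM R) (@normc1 R)). Qed.

Lemma normcX z n : normc (z ^+ n) = normc z ^+ n.
Proof. by elim: n => [|n IH]; rewrite ?normc1// !exprS normcM IH. Qed.

Lemma normc_sum (I : Type) (s : seq I) (P : pred I) (F : I -> R[i]) :
  normc (\sum_(i <- s | P i) F i) <= \sum_(i <- s | P i) normc (F i).
Proof.
elim/big_ind2: _ => [|x1 x2 y1 y2 h1 h2|//]; first by rewrite normc0.
by rewrite (le_trans (le_normcD _ _))// lerD.
Qed.

Lemma normc_natr n : normc (n%:R : R[i]) = n%:R.
Proof. by rewrite normcMn normc1. Qed.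

Lemma geometric_sum_bounded w : normc w = 1 -> w != 1 ->
  exists K : R, forall n, normc (\sum_(k < n) w ^+ k) <= K.
Proof.
move=> w1 wn1; exists (2 / normc (w - 1)) => n.
have w10 : 0 < normc (w - 1).
  rewrite lt0r normc_ge0 andbT; apply: contra wn1 => /eqP/eq0_normc/eqP.
  by rewrite subr_eq0.
rewrite ler_pdivlMr// mulrC -normcM -subrX1 (le_trans (le_normcD _ _))//.
by rewrite normcN normcX w1 expr1n normc1.
Qed.

End unit_circle.

(** * Kronecker's theorem *)

(** The ratio of consecutive central binomials is 2 (2 p + 1) / (p + 1), and
    2 (2 p + 3) >= 4 (p + 1). *)
Lemma le_central_bin p : (4 ^ p <= p.*2.+1 * 'C(p.*2, p))%N.
Proof.
elim: p => [|p IH]; first by rewrite bin0.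
have step : (p.+1 * 'C(p.+1.*2, p.+1) = 2 * p.*2.+1 * 'C(p.*2, p))%N.
  have h1 := mul_bin_diag p.+1.*2 p; rewrite doubleS /= in h1 *.
  have h2 := mul_bin_left p.*2.+1 p.
  have h3 := mul_bin_diag p.*2.+1 p; rewrite /= in h3.
  have h4 := mul_bin_left p.*2 p.
  have e : 'C(p.*2.+1, p.+1) = 'C(p.*2.+1, p).
    by rewrite -[LHS]bin_sub; [congr 'C(_, _); lia | lia].
  move: h1 h2 h3 h4; rewrite e => h1 h2 h3 h4; nia.
rewrite -(@leq_pmul2l p.+1)// mulnCA step doubleS expnS; nia.
Qed.

Lemma exists_poly_geometric_lt1 (R : realType) (q : R) d : 0 <= q < 1 ->
  exists p : nat, (p.*2.+1)%:R ^+ d * q ^+ p < 1.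
Proof.
move=> /andP[q0 q1]; have [->|qn0] := eqVneq q 0.
  by exists 1%N; rewrite expr1 mulr0.
have {q0 qn0}q0 : 0 < q by rewrite lt0r qn0.
pose h := q^-1 - 1.
have h0 : 0 < h by rewrite subr_gt0 invf_gt1.
have qh : q^-1 = 1 + h by rewrite /h; ring.
have bern n : n%:R * h <= q^-1 ^+ n.
  rewrite qh; elim: n => [|n IH]; first by rewrite mul0r.
  have : 1 <= (1 + h) ^+ n by rewrite exprn_ege1//; lra.
  by rewrite exprS -natr1; nra.
have qn n : (0 < n)%N -> q ^+ n <= (n%:R * h)^-1.
  move=> n0; rewrite -[q]invrK exprVn lef_pV2 ?bern// posrE.
    by rewrite exprn_gt0// invr_gt0.
  by rewrite mulr_gt0// ltr0n.
pose c : R := (3 * d.+1)%:R / h.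
have c0 : 0 < c by rewrite divr_gt0// ltr0n.
pose n := (Num.bound (c ^+ d / h)).+1.
have n0 : 0 < n%:R :> R by rewrite ltr0n.
have hn : c ^+ d / h < n%:R.
  have := archi_boundP (ltW (divr_gt0 (exprn_gt0 d c0) h0)).
  by move=> /lt_trans; apply; rewrite ltr_nat.
exists (n * d.+1)%N.
(* With p = n (d + 1), q ^ p is at most (n h) ^ - (d + 1): one factor more than
   is needed to beat the polynomial. *)
have b1 : (((n * d.+1).*2.+1)%:R : R) <= c * (n%:R * h).
  have -> : c * (n%:R * h) = (3 * d.+1 * n)%:R.
    by rewrite /c natrM; field; rewrite gt_eqF.
  by rewrite ler_nat /n; nia.
have b2 : q ^+ (n * d.+1) <= (n%:R * h)^-1 ^+ d.+1.
  rewrite exprM lerXn2r// ?nnegrE; last exact: qn.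
    by rewrite exprn_ge0// ltW.
  by rewrite invr_ge0 mulr_ge0// ltW.
have nh0 : 0 < n%:R * h by rewrite mulr_gt0.
apply: (@le_lt_trans _ _ ((c * (n%:R * h)) ^+ d * (n%:R * h)^-1 ^+ d.+1)).
  apply: ler_pM => //; rewrite ?exprn_ge0 ?ler0n ?(ltW q0)//.
  by rewrite lerXn2r// ?nnegrE ?ler0n// mulr_ge0// ltW.
rewrite exprMn exprS [_^-1 * _]mulrC -mulrA [X in _ * X]mulrA -exprMn divff.
  by rewrite expr1n mul1r ltr_pdivrMr// mul1r -ltr_pdivrMr.
by rewrite gt_eqF.
Qed.

Lemma le_of_linear_growth (R : realType) (a b K : R) :
  (forall n : nat, n%:R * a <= n%:R * b + K) -> a <= b.
Proof.
move=> H; rewrite leNgt; apply/negP => ba.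
have K0 : 0 <= K by have := H 0%N; lra.
have ab0 : 0 < a - b by rewrite subr_gt0.
have := archi_boundP (divr_ge0 K0 (ltW ab0)).
by rewrite ltr_pdivrMr//; have := H (Num.bound (K / (a - b))); nra.
Qed.

Section kronecker.
Context {R : realType} {d : nat}.
Variable (alpha : 'rV[R]_d).
Hypothesis halpha : irrational_vec alpha.

(** Irrationality with the denominators cleared. *)
Lemma irrational_int (c : 'I_d -> int) (n : int) :
  \sum_i (c i)%:~R * alpha ord0 i = n%:~R -> forall i, c i = 0.
Proof.
move=> e i.
have [|_ /(_ i)/eqP] := halpha (q0 := - n%:~R) (q := fun i => (c i)%:~R).
  rewrite mulr1 rmorphN /= ratr_int -e addrC; apply/eqP; rewrite subr_eq0.
  by apply/eqP; apply: eq_bigr => j _; rewrite ratr_int.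
by rewrite intr_eq0 => /eqP.
Qed.

Variable (y : 'rV[R]_d).

(* Up to unimodular factors, [peak p k] is the value at k alpha - y of a
   non-negative trigonometric polynomial, large only where that vector is close
   to the lattice. *)
Let phase (k : nat) (i : 'I_d) : R[i] :=
  circle_exp (k%:R * alpha ord0 i - y ord0 i).
Let peak (p k : nat) : R[i] :=
  \prod_i ((1 + phase k i) ^+ p.*2 * phase k i ^- p).

Let freq p (f : {ffun 'I_d -> 'I_p.*2.+1}) : R :=
  \sum_i ((f i)%:R - p%:R) * alpha ord0 i.
Let coef p (f : {ffun 'I_d -> 'I_p.*2.+1}) : R[i] :=
  \prod_i ('C(p.*2, f i)%:R * circle_exp (- (((f i)%:R - p%:R) * y ord0 i))).
Let centre p : {ffun 'I_d -> 'I_p.*2.+1} := [ffun=> inord p].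

Let peak_expansion p k :
  peak p k = \sum_(f : {ffun 'I_d -> 'I_p.*2.+1}) coef f * circle_exp (freq f) ^+ k.
Proof.
rewrite /peak.
under eq_bigr => i _ do rewrite exprDn big_distrl /=.
rewrite bigA_distr_bigA /=; apply: eq_bigr => f _.
rewrite -circle_expMn mulr_sumr circle_exp_sum -big_split /=.
apply: eq_bigr => i _; rewrite expr1n mul1r -mulr_natl -!mulrA; congr (_ * _).
rewrite /phase -!circle_expMn -circle_expN -!circle_expD; congr circle_exp.
by ring.
Qed.

Let freq_centre p (f : {ffun 'I_d -> 'I_p.*2.+1}) :
  circle_exp (freq f) = 1 -> f = centre p.
Proof.
move=> /circle_exp_eq1[n fn]; apply/ffunP => i; rewrite ffunE.
have fp : (f i : int) - p%:Z = 0.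
  apply: (@irrational_int (fun i => (f i : int) - p%:Z) n).
  by rewrite -fn; apply: eq_bigr => j _; rewrite rmorphB.
by apply/val_inj; rewrite /= inordK; lia.
Qed.

Let coef_centre p : coef (centre p) = ('C(p.*2, p) ^ d)%:R.
Proof.
rewrite /coef natrX; transitivity (\prod_(i < d) ('C(p.*2, p)%:R : R[i])).
  apply: eq_bigr => i _.
  by rewrite ffunE inordK ?subrr ?mul0r ?oppr0 ?circle_exp0 ?mulr1//; lia.
by rewrite prodr_const card_ord.
Qed.

Let circle_exp_freq_centre p : circle_exp (freq (centre p)) = 1.
Proof.
rewrite /freq big1 ?circle_exp0// => i _.
by rewrite ffunE inordK ?subrr ?mul0r//; lia.
Qed.

(** The time average of [peak p] is its constant coefficient: by irrationality
    every other frequency averages out. *)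
Lemma central_coef_le_peak p (M : R) : (forall k, normc (peak p k) <= M) ->
  ('C(p.*2, p) ^ d)%:R <= M.
Proof.
move=> peakM.
have /choice[K HK] (f : {ffun 'I_d -> 'I_p.*2.+1}) : exists K : R,
    f != centre p -> forall n,
    normc (\sum_(k < n) coef f * circle_exp (freq f) ^+ k) <= K.
  have [->|fp] := eqVneq f (centre p); first by exists 0.
  have [|K HK] := geometric_sum_bounded (normc_circle_exp (freq f)).
    by apply: contra fp => /eqP/freq_centre ->.
  exists (normc (coef f) * K) => _ n; rewrite -mulr_sumr normcM.
  by rewrite ler_wpM2l ?normc_ge0.
apply: (@le_of_linear_growth _ _ _ (\sum_(f | f != centre p) K f)) => n.
have -> : n%:R * ('C(p.*2, p) ^ d)%:R
    = normc (\sum_(k < n) coef (centre p) * circle_exp (freq (centre p)) ^+ k).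
  under eq_bigr => k _ do rewrite circle_exp_freq_centre expr1n mulr1 coef_centre.
  by rewrite sumr_const card_ord -mulrnA normc_natr mulnC natrM.
have -> : \sum_(k < n) coef (centre p) * circle_exp (freq (centre p)) ^+ k
   = \sum_(k < n) peak p k - \sum_(f | f != centre p)
       \sum_(k < n) coef f * circle_exp (freq f) ^+ k.
  rewrite [X in _ - X]exchange_big /= -sumrB; apply: eq_bigr => k _.
  by rewrite peak_expansion (bigD1 (centre p))//= addrK.
rewrite (le_trans (le_normcD _ _))// normcN lerD//.
  rewrite (le_trans (normc_sum _ _ _))//.
  apply: (@le_trans _ _ (\sum_(k < n) M)); first by apply: ler_sum => k _.
  by rewrite sumr_const card_ord mulr_natl.
rewrite (le_trans (normc_sum _ _ _))//; apply: ler_sum => f fp; exact: HK.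
Qed.

(** If the multiples of alpha kept away from y modulo 1, then at every time one
    factor of [peak p] would be exponentially small in p compared with its
    maximum 4 ^ p. So would be the constant coefficient C(2 p, p) ^ d compared
    with 4 ^ (p d), but their ratio is only polynomially small. *)
Lemma kronecker r : 0 < r -> exists (k : nat) (m : 'I_d -> int),
  forall i, `|k%:R * alpha ord0 i + (m i)%:~R - y ord0 i| < r.
Proof.
move=> r0; apply: contrapT => /forallNP far.
have {}far k : exists i, forall n : int,
    r <= `|k%:R * alpha ord0 i - y ord0 i - n%:~R|.
  apply: contrapT => /forallNP near; apply: (far k).
  have /choice[m Hm] i : exists m : int,
      `|k%:R * alpha ord0 i - y ord0 i - m%:~R| < r.
    have /existsNP[n /negP] := near i; rewrite -ltNge => ?.
    by exists n.
  exists (fun i => - m i) => i; rewrite mulrNz addrAC; exact: Hm.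
have [q q01 Hq] := normc_1D_circle_exp_far r0.
have [p] := exists_poly_geometric_lt1 d q01; apply/negP; rewrite -leNgt.
have : ('C(p.*2, p) ^ d)%:R <= (4 ^+ d * q) ^+ p :> R.
  apply: central_coef_le_peak => k.
  rewrite /peak normc_prod.
  have -> : \prod_i normc ((1 + phase k i) ^+ p.*2 * phase k i ^- p) =
            (\prod_i (normc (1 + phase k i) ^+ 2)) ^+ p.
    rewrite -prodrXl; apply: eq_bigr => i _.
    rewrite normcM normcV !normcX normc_circle_exp expr1n invr1 mulr1.
    by rewrite -exprM mul2n.
  apply: lerXn2r; rewrite ?nnegrE.
  - by apply: prodr_ge0 => i _; rewrite sqr_ge0.
  - by case/andP: q01 => q0 _; rewrite mulr_ge0.
  have [i0 Hi0] := far k; rewrite (bigD1 i0)//=.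
  have -> : 4 ^+ d * q = (4 * q) * \prod_(i < d | i != i0) 4.
    transitivity (\prod_(i < d) (4 : R) * q).
      by rewrite prodr_const card_ord.
    by rewrite (bigD1 i0)//= mulrAC.
  apply: ler_pM; rewrite ?sqr_ge0 ?Hq//.
    by apply: prodr_ge0 => i _; rewrite sqr_ge0.
  by apply: ler_prod => i _; rewrite sqr_ge0 normc_1D_circle_exp_le4.
move=> ub.
have lb : (4 ^+ p) ^+ d <= (p.*2.+1)%:R ^+ d * ('C(p.*2, p) ^ d)%:R :> R.
  rewrite (natrX _ 'C(_, _)) -exprMn -natrM -natrX.
  by rewrite lerXn2r ?nnegrE ?ler0n// ler_nat le_central_bin.
have pos : 0 < (4 ^+ p) ^+ d :> R by rewrite !exprn_gt0.
rewrite -(ler_pM2l pos) mulr1 (le_trans lb)// mulrCA ler_wpM2l ?exprn_ge0//.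
by rewrite exprAC -exprMn.
Qed.
End kronecker.

(** * Ranks in a finite set *)

Section rank.
Context {T : choiceType} {R : realType}.
Variable key : T -> R.
Hypothesis key_inj : injective key.
Implicit Types (A : set T) (t : T).

Definition card_set A : nat := #|` fset_set A|.
Definition rank A t : nat := card_set (A `&` [set u | key u < key t]).

Lemma card_proper A B t : finite_set B -> A `<=` B -> B t -> ~ A t ->
  (card_set A < card_set B)%N.
Proof.
move=> Bfin AB Bt At; have Afin := sub_finite_set AB Bfin.
apply: fproper_ltn_card; rewrite fproperE; apply/andP; split.
  by apply/fsubsetP => u; rewrite !in_fset_set// !inE => /AB.
by apply/negP => /fsubsetP/(_ t); rewrite !in_fset_set// !inE => /(_ Bt).
Qed.

Lemma rank_lt_card A t : finite_set A -> A t -> (rank A t < card_set A)%N.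
Proof.
by move=> Afin At; apply: (card_proper Afin _ At) => [u []//|[_ /=]]; rewrite ltxx.
Qed.

Lemma rank_lt A t u : finite_set A -> A t -> key t < key u ->
  (rank A t < rank A u)%N.
Proof.
move=> Afin At tu; apply: (@card_proper _ _ t).
- by apply: sub_finite_set Afin => v [].
- by move=> v [Av /= vt]; split=> //=; exact: lt_trans tu.
- by [].
- by move=> [_ /=]; rewrite ltxx.
Qed.

Lemma rank_inj A t u : finite_set A -> A t -> A u -> rank A t = rank A u -> t = u.
Proof.
move=> Afin At Au rtu; apply: key_inj; apply/eqP; rewrite eq_le !leNgt.
by apply/andP; split; apply/negP => /(rank_lt Afin) h;
  [have := h Au|have := h At]; rewrite rtu ltnn.
Qed.

(** An injective map into an initial segment of the same finite size is onto. *)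
Lemma rank_surj A r : finite_set A -> (r < card_set A)%N -> exists2 t, A t & rank A t = r.
Proof.
move=> Afin rA; pose B := fset_set A.
have inB (t : B) : A (val t).
  by have := valP t; rewrite in_fset_set// inE.
pose f (t : B) : 'I_#|` B| := Ordinal (rank_lt_card Afin (inB t)).
have finj : injective f.
  move=> t u /(congr1 val) /= rtu; apply: val_inj.
  exact: (rank_inj Afin (inB t) (inB u)).
have [g fK gK] : bijective f by apply: inj_card_bij; rewrite // card_ord -cardfE.
by exists (val (g (Ordinal rA))); [exact: inB | have /(congr1 val) := gK (Ordinal rA)].
Qed.

End rank.

Lemma card_bij (T : choiceType) (A B : set T) (f g : T -> T) :
  finite_set B -> cancel f g -> cancel g f -> (forall t, A t <-> B (f t)) ->
  card_set A = card_set B.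
Proof.
move=> Bfin fK gK AB.
have -> : A = g @` B.
  apply/seteqP; split=> [t /AB|_ [t Bt <-]]; first by exists (f t).
  by apply/AB; rewrite gK.
by rewrite /card_set fset_set_image// card_imfset//; exact: can_inj gK.
Qed.

(** * Lattice fibres and visits along an orbit *)

Section lattice.
Context {R : realType} {d : nat}.
Implicit Types (x y : 'rV[R]_d) (m : 'rV[int]_d) (S : set 'rV[R]_d).

Lemma ZvecD m1 m2 : Zvec R (m1 + m2) = Zvec R m1 + Zvec R m2.
Proof. by apply/rowP => i; rewrite !mxE rmorphD. Qed.

Lemma ZvecN m : Zvec R (- m) = - Zvec R m.
Proof. by apply/rowP => i; rewrite !mxE rmorphN. Qed.

Lemma Zvec0 : Zvec R (0 : 'rV[int]_d) = 0.
Proof. by apply/rowP => i; rewrite !mxE. Qed.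

(** The lattice points of the cube [-L, L]^d, indexed by a finite type. *)
Definition zbox L (f : {ffun 'I_d -> 'I_L.*2.+1}) : 'rV[int]_d :=
  \row_i ((f i : nat)%:Z - L%:Z).

Lemma zbox_exists L m : (forall i, `|m ord0 i| <= L%:Z) ->
  exists f : {ffun 'I_d -> 'I_L.*2.+1}, zbox f = m.
Proof.
move=> mL; exists [ffun i => inord (absz (m ord0 i + L%:Z))].
apply/rowP => i; rewrite !mxE ffunE; move: (m ord0 i) (mL i) => z {mL}.
by rewrite ler_norml => /andP[h1 h2]; rewrite inordK; lia.
Qed.

Lemma zbox_finite L : finite_set [set m : 'rV[int]_d | forall i, `|m ord0 i| <= L%:Z].
Proof.
apply: (@sub_finite_set _ _ (range (@zbox L))).
  by move=> m /zbox_exists[f <-]; exists f.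
exact/finite_image/finite_finset.
Qed.

(** The points of S over the torus point of x, as lattice displacements. *)
Definition fibre S x : set 'rV[int]_d := [set m | S (x + Zvec R m)].

Lemma le_mxnorm x i : `|x ord0 i| <= `|x|.
Proof.
by rewrite [leRHS]/Num.norm /= mx_normrE; apply: (le_bigmax _ _ (ord0, i)). Qed.

Lemma bounded_coord S : bounded_set S ->
  exists M : nat, forall x, S x -> forall i, `|x ord0 i| <= M%:R.
Proof.
move=> /pinfty_ex_gt0[M M0 SM]; exists (Num.bound M) => x Sx i.
rewrite (le_trans (le_mxnorm x i))// (le_trans (SM x Sx))//.
by rewrite ltW// archi_boundP// ltW.
Qed.

(** Makes sums over the lattice and searches for displacements finite. *)
Lemma lattice_step_bounded (M L : nat) x y m :
  (forall i, `|x ord0 i| <= L%:R) -> (forall i, `|y ord0 i| <= M%:R) ->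
  y = x + Zvec R m -> forall i, `|m ord0 i| <= (L + M)%:Z.
Proof.
move=> xL yM e i.
have -> : (`|m ord0 i| <= (L + M)%:Z) = (`|(m ord0 i)%:~R : R| <= (L + M)%:R).
  by rewrite -intr_norm -[_%:R]/((L + M)%:Z%:~R) ler_int.
have -> : (m ord0 i)%:~R = y ord0 i - x ord0 i :> R.
  by rewrite e !mxE addrAC subrr add0r.
by rewrite natrD (le_trans (ler_normB _ _))// addrC lerD.
Qed.

Lemma fibre_finite S x : bounded_set S -> finite_set (fibre S x).
Proof.
move=> /bounded_coord[M SM].
apply: (@sub_finite_set _ _ _ _ (@zbox_finite (Num.bound `|x| + M))) => m Sm.
apply: (lattice_step_bounded (x := x) (y := x + Zvec R m)) => //; last exact: SM.
move=> i; rewrite (le_trans (le_mxnorm x i))// ltW// archi_boundP//.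
Qed.

Definition fibre_card S x : nat := card_set (fibre S x).

Lemma chiE S x : bounded_set S -> chi S x = (fibre_card S x)%:R.
Proof.
move=> bS; have fin := fibre_finite x bS.
rewrite /chi -(@fsbig_widen _ _ _ _ (fibre S x))//; last first.
  move=> m [_ /= nS]; rewrite indicE memNset//.
rewrite fsbig_finite//= (eq_big_seq (fun=> 1)) => [|m].
  by rewrite big_const_seq count_predT iter_addr_0.
by rewrite in_fset_set// inE => Sm; rewrite indicE mem_set.
Qed.

End lattice.

Section orbit.
Context {R : realType} {d : nat}.
Variable (alpha : 'rV[R]_d).
Hypothesis halpha : irrational_vec alpha.
Implicit Types (x y : 'rV[R]_d) (m : 'rV[int]_d) (S : set 'rV[R]_d).

(** By irrationality this is injective, so it orders Z^d totally; being additive,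
    the order does not depend on the base point of the fibre. *)
Definition height m : R := \sum_i (m ord0 i)%:~R * alpha ord0 i.

Lemma heightD m1 m2 : height (m1 + m2) = height m1 + height m2.
Proof.
rewrite /height -big_split; apply: eq_bigr => i _.
by rewrite !mxE rmorphD /= mulrDl.
Qed.

Lemma height_inj : injective height.
Proof.
move=> m1 m2 e; apply/rowP => i.
have e0 : height (m1 - m2) = 0.
  by apply: (addIr (height m2)); rewrite -heightD subrK add0r.
have := irrational_int halpha (c := fun i => (m1 - m2) ord0 i) (n := 0) e0 i.
by rewrite !mxE => /eqP; rewrite subr_eq0 => /eqP.
Qed.

Definition fibre_rank S x m : nat := rank height (fibre S x) m.

Lemma fibre_rank_shift S x m m' : bounded_set S ->
  fibre_rank S (x + Zvec R m) m' = fibre_rank S x (m + m').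
Proof.
move=> bS; apply: (@card_bij _ _ _ (fun u => m + u) (fun u => u - m)).
- by apply: sub_finite_set (fibre_finite x bS) => ? [].
- by move=> u; rewrite addrC addKr.
- by move=> u; rewrite addrC subrK.
move=> u; rewrite /fibre /= ZvecD addrA.
by rewrite !heightD ltrD2l.
Qed.

Lemma fibre_card_shift S x m : bounded_set S ->
  fibre_card S (x + Zvec R m) = fibre_card S x.
Proof.
move=> bS; apply: (@card_bij _ _ _ (fun u => m + u) (fun u => u - m)).
- exact: fibre_finite.
- by move=> u; rewrite addrC addKr.
- by move=> u; rewrite addrC subrK.
by move=> u; rewrite /fibre /= ZvecD addrA.
Qed.

Definition visits S n x : nat := \sum_(k < n) fibre_card S (x + k%:R *: alpha).

Lemma visits0 S x : visits S 0 x = 0%N.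
Proof. by rewrite /visits big_ord0. Qed.

Lemma visits_shift S n x m : bounded_set S ->
  visits S n (x + Zvec R m) = visits S n x.
Proof.
by move=> bS; apply: eq_bigr => k _; rewrite addrAC fibre_card_shift.
Qed.

Lemma visitsD S n k x :
  visits S (n + k) x = (visits S n x + visits S k (x + n%:R *: alpha))%N.
Proof.
rewrite /visits big_split_ord /=; congr (_ + _)%N; apply: eq_bigr => i _.
by rewrite natrD scalerDl addrA.
Qed.

Lemma visits1 S x : visits S 1 x = fibre_card S x.
Proof. by rewrite /visits big_ord1 scale0r addr0. Qed.

Lemma visitsS S n x :
  visits S n.+1 x = (visits S n x + fibre_card S (x + n%:R *: alpha))%N.
Proof. by rewrite -addn1 visitsD visits1. Qed.

Lemma leq_visits S n k x : (n <= k)%N -> (visits S n x <= visits S k x)%N.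
Proof. by move=> /subnKC <-; rewrite visitsD leq_addr. Qed.

(** The points of S met along the forward orbit of x are listed by time, and at
    equal times by height; the index of a point in this list determines it. *)
Lemma visit_index_inj S x n m n' m' : bounded_set S ->
  fibre S (x + n%:R *: alpha) m -> fibre S (x + n'%:R *: alpha) m' ->
  (visits S n x + fibre_rank S (x + n%:R *: alpha) m =
   visits S n' x + fibre_rank S (x + n'%:R *: alpha) m')%N -> n = n' /\ m = m'.
Proof.
move=> bS Sm Sm' e.
have lt_next k u : fibre S (x + k%:R *: alpha) u ->
    (visits S k x + fibre_rank S (x + k%:R *: alpha) u < visits S k.+1 x)%N.
  move=> Su; rewrite visitsS ltn_add2l; apply: rank_lt_card => //.
  exact: fibre_finite.
have nn' : n = n'.
  case: (ltngtP n n') => // lt.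
    by have := leq_trans (lt_next _ _ Sm) (leq_visits S x lt); rewrite e ltnNge leq_addr.
  by have := leq_trans (lt_next _ _ Sm') (leq_visits S x lt); rewrite -e ltnNge leq_addr.
split => //; rewrite -{}nn' in e Sm'.
apply: (rank_inj height_inj _ Sm Sm'); first exact: fibre_finite.
by move/addnI: e.
Qed.

(** Ranks exhaust each fibre, so the list has no gaps. *)
Lemma visit_index_surj S x n i : bounded_set S -> (i < visits S n x)%N ->
  exists k m, [/\ (k < n)%N, fibre S (x + k%:R *: alpha) m &
    (visits S k x + fibre_rank S (x + k%:R *: alpha) m)%N = i].
Proof.
move=> bS; elim: n => [|n IH]; first by rewrite visits0.
case: (ltnP i (visits S n x)) => [/IH[k [m [kn Sm e]]] _|].
  by exists k, m; split=> //; exact: ltnW.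
move=> le; rewrite visitsS => lt.
have [|m Sm rm] := rank_surj height_inj (r := i - visits S n x)
  (fibre_finite (x + n%:R *: alpha) bS).
  by rewrite -(ltn_add2l (visits S n x)) subnKC.
by exists n, m; split=> //; rewrite /fibre_rank rm subnKC.
Qed.

End orbit.

(** * The queue *)

Section queue.
Context {R : realType} {d : nat}.
Variables (alpha : 'rV[R]_d) (S S' : set 'rV[R]_d).
Hypotheses (bS : bounded_set S) (bS' : bounded_set S').
Implicit Types (x s : 'rV[R]_d) (m : 'rV[int]_d).

Definition excess n x : int := (visits alpha S n x)%:Z - (visits alpha S' n x)%:Z.

Lemma excessD n k x :
  excess (n + k) x = excess n x + excess k (x + n%:R *: alpha).
Proof. by rewrite /excess !visitsD !PoszD; ring. Qed.

Lemma excess_shift n x m : excess n (x + Zvec R m) = excess n x.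
Proof. by rewrite /excess !visits_shift. Qed.

Variables (G : set 'rV[R]_d) (D : int) (W : nat).
Hypothesis GD : forall x v, G x -> Zalpha_Zd alpha v -> G (x + v).
Hypothesis excess_range : forall x, G x -> forall n1 n2,
  excess n1 x - excess n2 x <= D.
Hypothesis excess_range_attained : forall x, G x -> exists n1 n2,
  [/\ (n1 < W)%N, (n2 < W)%N & excess n1 x - excess n2 x = D].

Lemma Zalpha_nat n : Zalpha_Zd alpha (n%:R *: alpha).
Proof. by exists n%:Z, 0; rewrite Zvec0 addr0. Qed.

(** The largest future deficit of arrivals, over a finite window. Truncated
    subtraction does no harm, the term n = 0 being 0 anyway. *)
Definition queue x : nat :=
  \max_(n < W.+1) (visits alpha S' n x - visits alpha S n x)%N.

Lemma queue_shift x m : queue (x + Zvec R m) = queue x.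
Proof. by apply: eq_bigr => n _; rewrite !visits_shift. Qed.

(* A time in the window at which the excess is minimal over all times. *)
Let queue_min x j : (j < W.+1)%N -> (forall n, excess j x <= excess n x) ->
  (queue x)%:Z = - excess j x.
Proof.
move=> jW jmin; apply/eqP; rewrite eq_le; apply/andP; split.
  have le0 := jmin 0%N; rewrite /excess !visits0 in le0.
  have : (queue x <= absz (excess j x))%N.
    apply/bigmax_leqP => n _; have := jmin n; rewrite /excess in le0 *.
    move: (visits _ _ _ _) (visits _ _ _ _) (visits _ _ _ _) (visits _ _ _ _) le0.
    lia.
  move: le0; rewrite -/(excess j x); lia.
have : (visits alpha S' j x - visits alpha S j x <= queue x)%N.
  exact: (leq_bigmax (F := fun n : 'I_W.+1 => _) (Ordinal jW)).
rewrite /excess /=; move: (queue x).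
move: (visits _ _ _ _) (visits _ _ _ _); lia.
Qed.

Let excess_min x n1 n2 : G x -> excess n1 x - excess n2 x = D ->
  forall n, excess n2 x <= excess n x.
Proof. by move=> Gx e n; have := excess_range Gx n1 n; rewrite -e; lia. Qed.

Lemma queue_le x : G x -> (queue x)%:Z <= D.
Proof.
move=> Gx; have [n1 [n2 [_ n2W e]]] := excess_range_attained Gx.
rewrite (queue_min (leqW n2W) (excess_min Gx e)).
have := excess_range Gx 0 n2; rewrite {1}/excess !visits0; lia.
Qed.

(** An oscillation of the maximal size D seen from x + alpha is also one seen
    from x, one step later, so its low point is the minimum of the excess over
    the whole future both of x and of x + alpha. *)
Lemma queue_balance x : G x ->
  (queue x + fibre_card S x = queue (x + alpha) + fibre_card S' x)%N.
Proof.
move=> Gx; have Gx1 : G (x + alpha).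
  by apply: GD => //; have := Zalpha_nat 1; rewrite scale1r.
have [n1 [n2 [_ n2W e]]] := excess_range_attained Gx1.
have q1 := queue_min (leqW n2W) (excess_min Gx1 e).
have step n : excess (1 + n) x =
    (fibre_card S x)%:Z - (fibre_card S' x)%:Z + excess n (x + alpha).
  by rewrite excessD scale1r /excess !visits1.
have e' : excess (1 + n1) x - excess (1 + n2) x = D by rewrite !step -e; ring.
have q0 := queue_min (n2W : (1 + n2 < W.+1)%N) (excess_min Gx e').
rewrite step in q0; move: q0 q1.
move: (queue x) (queue _) (fibre_card S x) (fibre_card S' x) (excess _ _); lia.
Qed.

End queue.

(** * First come, first served *)

Section matching.
Context {R : realType} {d : nat}.
Variables (alpha : 'rV[R]_d) (S S' : set 'rV[R]_d).
Hypothesis halpha : irrational_vec alpha.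
Hypotheses (bS : bounded_set S) (bS' : bounded_set S').
Variables (G : set 'rV[R]_d) (q : 'rV[R]_d -> nat) (N : nat).
Hypothesis GD : forall x v, G x -> Zalpha_Zd alpha v -> G (x + v).
Hypothesis q_shift : forall x m, q (x + Zvec R m) = q x.
Hypothesis q_balance : forall x, G x ->
  (q x + fibre_card S x = q (x + alpha) + fibre_card S' x)%N.
Hypothesis q_le_visits : forall x y, G x -> (q x <= visits alpha S' N y)%N.
Implicit Types (x s : 'rV[R]_d) (m : 'rV[int]_d) (n : nat).

Local Notation fibre_rank := (fibre_rank alpha).
Local Notation visits := (visits alpha).

(** The customer s is served by s + n alpha + m. On the left, those who wait
    before s when s arrives; on the right, the services offered before that one. *)
Definition served s n m : Prop := fibre S' (s + n%:R *: alpha) m /\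
  (q s + fibre_rank S s 0 = visits S' n s + fibre_rank S' (s + n%:R *: alpha) m)%N.

Lemma q_balance_iter x n : G x ->
  (q x + visits S n x = q (x + n%:R *: alpha) + visits S' n x)%N.
Proof.
move=> Gx; elim: n => [|n IH]; first by rewrite !visits0 scale0r addr0.
have := q_balance (GD Gx (Zalpha_nat alpha n)).
rewrite !visitsS addnA IH -addrA.
have -> : n%:R *: alpha + alpha = n.+1%:R *: alpha.
  by rewrite -natr1 scalerDl scale1r.
by rewrite addnAC => ->; rewrite addnAC addnA.
Qed.

(** Waiting times are bounded: a customer and all who wait before it are fewer
    than the services on offer within N + 1 steps. *)
Lemma served_exists s : G s -> S s ->
  exists n m, (n < N.+1)%N /\ served s n m.
Proof.
move=> Gs Ss.
have fs : fibre S s 0 by rewrite /fibre /= Zvec0 addr0.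
have lt : (q s + fibre_rank S s 0 < visits S' (1 + N) s)%N.
  have := rank_lt_card (height alpha) (fibre_finite s bS) fs.
  have := q_balance Gs; rewrite visitsD visits1 scale1r.
  have Gs1 : G (s + alpha).
    by apply: GD => //; have := Zalpha_nat alpha 1; rewrite scale1r.
  have := q_le_visits (s + alpha) Gs1.
  rewrite -/(fibre_card S s) -/(fibre_rank S s 0).
  move: (q s) (q _) (fibre_card S s) (fibre_card S' s)
    (fibre_rank _ _ _) (visits _ _ _); lia.
have [n [m [nN Sm e]]] := visit_index_surj halpha bS' lt.
by exists n, m.
Qed.

Lemma served_uniq s n m n' m' : served s n m -> served s n' m' -> n = n' /\ m = m'.
Proof.
move=> [Sm e] [Sm' e']; apply: (visit_index_inj halpha bS' Sm Sm').
by rewrite -e -e'.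
Qed.

(* Read from the earlier customer s1, the queue equation turns both service
   indices into arrival indices, which determine the customer. *)
Let served_inj_le s1 s2 n1 n2 m1 m2 : (n2 <= n1)%N ->
  G s1 -> S s1 -> S s2 -> served s1 n1 m1 -> served s2 n2 m2 ->
  s1 + n1%:R *: alpha + Zvec R m1 = s2 + n2%:R *: alpha + Zvec R m2 -> s1 = s2.
Proof.
move=> n21 G1 Ss1 Ss2 [f1 e1] [f2 e2] e.
pose t := (n1 - n2)%N; pose u := m1 - m2; pose y := s1 + t%:R *: alpha.
have s2E : s2 = y + Zvec R u.
  rewrite /y /u ZvecD ZvecN /t natrB// scalerBl.
  apply: (addIr (n2%:R *: alpha + Zvec R m2)); rewrite addrA -e.
  apply/rowP => i; rewrite !mxE; ring.
have yn2 : y + n2%:R *: alpha = s1 + n1%:R *: alpha.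
  by rewrite /y -addrA -scalerDl -natrD subnK.
have s2n2 : s2 + n2%:R *: alpha = s1 + n1%:R *: alpha + Zvec R u.
  by rewrite s2E addrAC yn2.
have := q_balance_iter t G1.
rewrite -/y.
move: e2; rewrite s2n2 fibre_rank_shift// {1}/u subrK s2E
  q_shift fibre_rank_shift// addr0.
rewrite visits_shift// => e2.
move: e1; rewrite -(subnK n21) -/t visitsD -/y natrD scalerDl addrA -/y yn2 => e1 bal.
have key : (visits S 0 s1 + fibre_rank S (s1 + 0%:R *: alpha) 0 =
            visits S t s1 + fibre_rank S y u)%N.
  rewrite visits0 scale0r addr0; move: e1 e2 bal.
  move: (q s1) (q y) (fibre_rank _ _ _) (fibre_rank _ _ _) (fibre_rank _ _ _).
  move: (visits S t s1) (visits _ _ _) (visits _ _ _); lia.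
have [|| t0 u0] := visit_index_inj halpha bS _ _ key.
- by rewrite /fibre /= Zvec0 scale0r !addr0.
- by rewrite /fibre /= -s2E.
by rewrite -u0 Zvec0 addr0 /y -t0 scale0r addr0.
Qed.

Lemma served_inj s1 s2 n1 n2 m1 m2 :
  G s1 -> G s2 -> S s1 -> S s2 -> served s1 n1 m1 -> served s2 n2 m2 ->
  s1 + n1%:R *: alpha + Zvec R m1 = s2 + n2%:R *: alpha + Zvec R m2 -> s1 = s2.
Proof.
move=> G1 G2 Ss1 Ss2 h1 h2 e; case: (leqP n2 n1) => n12.
  exact: (served_inj_le n12 G1 Ss1 Ss2 h1 h2 e).
exact/esym/(served_inj_le (ltnW n12) G2 Ss2 Ss1 h2 h1)/esym.
Qed.

(** Starting N steps before s', the queue present at the start has been served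
    before s', so s' serves one of the arrivals since. *)
Lemma served_surj s' : G s' -> S' s' -> exists s n m,
  [/\ (n < N.+1)%N, S s, served s n m & s' = s + n%:R *: alpha + Zvec R m].
Proof.
move=> Gs' Ss'; pose x := s' - N%:R *: alpha.
have Gx : G x.
  apply: GD => //; exists (- N%:Z), 0.
  by rewrite Zvec0 addr0 mulrNz scaleNr.
have xN : x + N%:R *: alpha = s' by rewrite subrK.
have fs' : fibre S' s' 0 by rewrite /fibre /= Zvec0 addr0.
have qx := q_le_visits x Gx.
have lt : (visits S' N x + fibre_rank S' s' 0 - q x < visits S N.+1 x)%N.
  have := rank_lt_card (height alpha) (fibre_finite s' bS') fs'.
  rewrite -/(fibre_card S' s') -/(fibre_rank S' s' 0).
  have := q_balance_iter N.+1 Gx; rewrite (visitsS _ S') xN; move: qx.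
  move: (q x) (q _) (fibre_card _ _) (fibre_rank _ _ _)
    (visits S' _ _) (visits S _ _); lia.
have [k [m [kN Sm e]]] := visit_index_surj halpha bS lt.
pose y := x + k%:R *: alpha; pose s := y + Zvec R m.
have yN : y + (N - k)%:R *: alpha = s'.
  by rewrite /y -addrA -scalerDl -natrD subnKC.
have sN : s + (N - k)%:R *: alpha = s' + Zvec R m by rewrite /s addrAC yN.
exists s, (N - k)%N, (- m); split.
- by rewrite ltnS leq_subr.
- by [].
- split; first by rewrite sN /fibre /= ZvecN addrK.
  rewrite sN fibre_rank_shift// subrr /s q_shift fibre_rank_shift// addr0 visits_shift//.
  have := q_balance_iter k Gx; move: e qx.
  rewrite -[in visits S' N x](subnKC (kN : (k <= N)%N)) visitsD -/y.
  move: (q x) (q y) (fibre_rank S y m) (fibre_rank S' s' 0)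
    (visits S' _ _) (visits S _ _).
  move: (visits S' _ _); lia.
by rewrite sN ZvecN addrK.
Qed.

End matching.

(** * Null sets *)

Section null_sets.
Context {R : realType} {d : nat}.
Implicit Types (A B : set 'rV[R]_d) (v : 'rV[R]_d).

Lemma mes_null_sub A B : A `<=` B -> mes B = 0%E -> mes A = 0%E.
Proof. by move=> AB B0; apply/eqP; rewrite eq_le mes_ge0 andbT -B0 le_mes. Qed.

Lemma mes_null_bigcup_nat (F : (set 'rV[R]_d)^nat) :
  (forall n, mes (F n) = 0%E) -> mes (\bigcup_n F n) = 0%E.
Proof.
move=> F0; apply/eqP; rewrite eq_le mes_ge0 andbT.
by rewrite (le_trans (mes_sigma_subadditive F))// eseries0.
Qed.

Lemma mes_null_bigcup (T : countType) (F : T -> set 'rV[R]_d) :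
  (forall t, mes (F t) = 0%E) -> mes (\bigcup_t F t) = 0%E.
Proof.
move=> F0; pose H n := if @choice.unpickle T n is Some t then F t else set0.
apply: (@mes_null_sub _ (\bigcup_n H n)).
  by move=> x [t _ Fx]; exists (choice.pickle t); rewrite // /H choice.pickleK.
apply: mes_null_bigcup_nat => n; rewrite /H.
by case: choice.unpickle => [t|]; [exact: F0 | exact: mes_set0].
Qed.

Lemma mes_null_setU A B : mes A = 0%E -> mes B = 0%E -> mes (A `|` B) = 0%E.
Proof.
move=> A0 B0; apply: (@mes_null_sub _ (\bigcup_b (if b then A else B))).
  by move=> x [Ax|Bx]; [exists true | exists false].
by apply: mes_null_bigcup => -[].
Qed.

Lemma mes_shift_le v A : (mes [set x : 'rV[R]_d | A (x + v)%R] <= mes A)%E.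
Proof.
apply: le_ereal_inf_tmp => _ [F [cF AF] <-].
pose e (I : 'rV[R]_d * 'rV[R]_d) := (I.1 - v, I.2 - v).
have e_inj : injective e.
  by move=> [a b] [a' b'] [/addIr -> /addIr ->].
have vol_e I : box_vol (e I) = box_vol I.
  rewrite /box_vol; congr (_%:E); apply: eq_bigr => i _.
  by rewrite /= !mxE opprB addrA subrK.
have -> : (\esum_(I in F) box_vol I = \esum_(I in e @` F) box_vol I)%E.
  rewrite esum_image; last by move=> ? ? _ _; exact: e_inj.
  by apply: eq_esum => I _; rewrite vol_e.
apply: ereal_inf_lbound; exists (e @` F) => //; split.
  exact: sub_countable (card_image_le e F) cF.
move=> x /AF[I FI Ix]; exists (e I); first by exists I.
by move=> i; move: (Ix i); rewrite /= !mxE lerBlDr ltrBrDr.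
Qed.

Lemma mes_null_shift v A : mes A = 0%E -> mes [set x : 'rV[R]_d | A (x + v)%R] = 0%E.
Proof.
move=> A0; apply/eqP; rewrite eq_le mes_ge0 andbT -A0; exact: mes_shift_le.
Qed.

Lemma ae_mes_null (P : set 'rV[R]_d) :
  {ae @lebesgue_rV R d, forall x : 'rV[R]_d, P x} -> mes (~` P) = 0%E.
Proof. by move=> [B [_ B0 PB]]; exact: mes_null_sub B0. Qed.

Definition orbit_free (alpha : 'rV[R]_d) (E : set 'rV[R]_d) : set 'rV[R]_d :=
  [set x : 'rV[R]_d | forall v, Zalpha_Zd alpha v -> ~ E (x + v)].

Lemma mes_orbit_free alpha E : mes E = 0%E -> mes (~` orbit_free alpha E) = 0%E.
Proof.
move=> E0; pose F (p : int * 'rV[int]_d) :=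
  [set x : 'rV[R]_d | E (x + (p.1%:~R *: alpha + Zvec R p.2))].
apply: (@mes_null_sub _ (\bigcup_p F p)).
  move=> x /existsNP[v /not_implyP[[n [m ->]] /contrapT Ex]].
  by exists (n, m).
by apply: mes_null_bigcup => p; exact: mes_null_shift.
Qed.

Lemma Zalpha_ZdD alpha v w :
  Zalpha_Zd alpha v -> Zalpha_Zd alpha w -> Zalpha_Zd alpha (v + w).
Proof.
move=> [n [m ->]] [n' [m' ->]]; exists (n + n'), (m + m').
by rewrite ZvecD rmorphD /= scalerDl addrACA.
Qed.

Lemma orbit_free_shift alpha E x v : orbit_free alpha E x ->
  Zalpha_Zd alpha v -> orbit_free alpha E (x + v).
Proof.
by move=> Ex av w aw; rewrite -addrA; apply: Ex; exact: Zalpha_ZdD.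
Qed.

End null_sets.

(** * Local constancy and minimality *)

Section topology.
Context {R : realType} {d : nat}.
Implicit Types (S P : set 'rV[R]_d) (x v : 'rV[R]_d).

Lemma near_translate x v P :
  (\forall y \near x + v, P y) -> \forall y \near x, P (y + v).
Proof.
rewrite (near_shift x (x + v)) => H; apply: filterS H => y /=.
by rewrite [x + v]addrC addrK.
Qed.

Lemma near_not_boundary S x : ~ boundary S x -> \forall y \near x, S y <-> S x.
Proof.
have [intx _|nint nb] := pselect (S^° x).
  have Sx : S x by exact: interior_subset intx.
  by apply: filterS intx => y Sy; split.
have : (~` S)^° x by rewrite interiorC => cl; exact: nb.
move=> /[dup] /interior_subset nSx H; apply: filterS H => y nSy.
by split=> [/nSy|/nSx].
Qed.

Lemma boundary_subC (G P : set 'rV[R]_d) :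
  (forall x, G x -> \forall y \near x, P y <-> P x) -> boundary P `<=` ~` G.
Proof.
move=> H x [clx nint] Gx; have Hx := H x Gx; apply: nint.
have [y [Py yx]] := clx _ Hx; have Px := (yx.1 Py).
by apply: filterS Hx => z [_]; apply.
Qed.

Lemma near_coord x (e : R) : 0 < e ->
  \forall y \near x, forall i, `|x ord0 i - (y : 'rV[R]_d) ord0 i| < e.
Proof.
move=> e0; apply/nbhs_ballP; exists e => // y.
by move=> [_ H] i; exact: H.
Qed.

(** Nearby points have their fibres in one and the same finite box, and
    membership in S is locally constant at each of the finitely many
    translates. *)
Lemma near_fibre S x : bounded_set S ->
  (forall m, ~ boundary S (x + Zvec R m)) ->
  \forall y \near x, fibre S y = fibre S x.
Proof.
move=> bS nb; have [M SM] := bounded_coord bS.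
pose X := (Num.bound `|x|).+1; pose L := (X + M)%N.
have xX (y : 'rV[R]_d) : (forall i, `|x ord0 i - y ord0 i| < 1) ->
    forall i, `|y ord0 i| <= X%:R.
  move=> yx i; have := le_mxnorm x i; have := archi_boundP (normr_ge0 x).
  have -> : y ord0 i = x ord0 i - (x ord0 i - y ord0 i) by rewrite subKr.
  have := ler_normB (x ord0 i) (x ord0 i - y ord0 i); have := yx i.
  rewrite /X -natr1; lra.
have H1 := near_coord x (ltr01 : 0 < 1 :> R).
have H2 : \forall y \near x, forall f : {ffun 'I_d -> 'I_L.*2.+1},
    S (y + Zvec R (zbox f)) <-> S (x + Zvec R (zbox f)).
  apply: (@filter_forall _ _ (fun (f : {ffun 'I_d -> 'I_L.*2.+1}) y =>
    S (y + Zvec R (zbox f)) <-> S (x + Zvec R (zbox f))) (nbhs x)) => f.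
  apply: (@near_translate x _ (fun y => S y <-> S (x + Zvec R (zbox f)))).
  exact: near_not_boundary.
apply: filterS2 H1 H2 => y yx H; apply/seteqP; split=> m Sm.
- have [|f fm] := @zbox_exists _ L m.
    exact: lattice_step_bounded (xX y yx) (SM (y + Zvec R m) Sm) erefl.
  by rewrite -fm; apply/H; rewrite fm.
- have [|f fm] := @zbox_exists _ L m.
    apply: (lattice_step_bounded (xX x _) (SM (x + Zvec R m) Sm) erefl) => i.
    by rewrite subrr normr0.
  by rewrite -fm; apply/H; rewrite fm.
Qed.

(** Minimality of the rotation; the bound is uniform in x by compactness of the
    unit cube, a fundamental domain of the lattice. *)
Lemma hitting_time (alpha : 'rV[R]_d) (U : set 'rV[R]_d) :
  irrational_vec alpha -> open U -> U !=set0 -> exists N : nat, forall x,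
    exists k m, (k < N)%N /\ U (x + k%:R *: alpha + Zvec R m).
Proof.
move=> halpha oU [u Uu].
have /nbhs_ballP[r r0 ballU] : nbhs u U by exact: open_nbhs_nbhs.
pose f (k : nat) := [set x : 'rV[R]_d | exists m, U (x + k%:R *: alpha + Zvec R m)].
have of_ k : open (f k).
  rewrite openE => x [m Um].
  have H : \forall y \near x, U (y + (k%:R *: alpha + Zvec R m)).
    by apply: (near_translate (P := U)); rewrite addrA;
      exact: (open_nbhs_nbhs (conj oU Um)).
  by apply: filterS H => y Uy; exists m; rewrite -addrA.
have hit x : exists k, f k x.
  have [k [m km]] := kronecker halpha (u - x) r0.
  exists k, (\row_i m i); apply: ballU; split => // i j.
  rewrite /ball /= ord1 -normrN opprB !mxE.
  have := km j; rewrite !mxE.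
  by have -> : x ord0 j + k%:R * alpha ord0 j + (m j)%:~R - u ord0 j =
     k%:R * alpha ord0 j + (m j)%:~R - (u ord0 j - x ord0 j) by ring.
have : compact [set x : 'rV[R]_d | forall i, `[(0 : R), 1]%classic (x ord0 i)].
  by apply: (@rV_compact R d (fun=> `[0, 1]%classic)) => _; exact: segment_compact.
rewrite compact_cover => /(_ nat setT f)[|x _|D _ Dcover].
- by move=> k _; exact: of_.
- by have [k fk] := hit x; exists k.
exists (\max_(k <- D) k).+1 => x.
pose fl : 'rV[int]_d := \row_i Num.floor (x ord0 i).
have [|k /= kD [m Um]] := Dcover (x - Zvec R fl).
  move=> i /=; rewrite in_itv /= !mxE; have := floor_itv (x ord0 i).
  rewrite rmorphD /=; lra.
exists k, (m - fl); split.
  by rewrite ltnS; apply: (@leq_bigmax_seq _ _ xpredT (fun k => k)).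
have -> : x + k%:R *: alpha + Zvec R (m - fl) =
    x - Zvec R fl + k%:R *: alpha + Zvec R m; last exact: Um.
by rewrite ZvecD ZvecN; apply/rowP => i; rewrite !mxE; ring.
Qed.

End topology.

(** * The decomposition *)

Section assembly.
Context {R : realType} {d : nat}.
Variable alpha : 'rV[R]_d.
Implicit Types (S P : set 'rV[R]_d) (x y s : 'rV[R]_d).

Lemma brs_visits S : bounded_remainder_set alpha S ->
  exists (E : set 'rV[R]_d) (C : R), [/\ mes E = 0%E, 0 <= C &
    forall x, ~ E x -> forall n,
      `|(visits alpha S n x)%:R - n%:R * fine (mes S)| <= C].
Proof.
move=> [bS _ [C HC]].
have visitsE n x : (visits alpha S n x)%:R =
    \sum_(0 <= k < n) chi S (x + k%:R *: alpha).
  rewrite big_mkord /visits natr_sum; apply: eq_bigr => k _; rewrite chiE//.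
pose E n := ~` [set x : 'rV[R]_d | `|(\sum_(0 <= k < n.+1) chi S (x + k%:R *: alpha))
  - n.+1%:R * fine (mes S)| <= C].
exists (\bigcup_n E n), `|C|; split=> //.
  by apply: mes_null_bigcup_nat => n; exact: ae_mes_null (HC _ (ltn0Sn n)).
move=> x xE [|n]; first by rewrite visits0 mul0r subrr normr0.
rewrite visitsE (le_trans _ (ler_norm C))//; apply: contrapT => xn.
by apply: xE; exists n.
Qed.

(** Up to null sets nothing has to be matched, and S is its own only piece. *)
Lemma null_equidecomposable (S S' : set 'rV[R]_d) : riemann_measurable S ->
  mes S = 0%E -> mes S' = 0%E ->
  riemann_equidecomposable (Zalpha_Zd alpha) S S'.
Proof.
move=> mS S0 S'0; have t0 : translate 0 S = S.
  by apply/seteqP; split=> [_ [x Sx <-]|x Sx]; rewrite ?addr0//; exists x; rewrite ?addr0.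
exists 1%N, (fun=> S), (fun=> 0); split=> //.
- by apply/seteqP; split=> [x [_ _]//|x Sx]; exists ord0.
- by move=> i j _ _ _; rewrite !ord1.
- by move=> _; exists 0, 0; rewrite scale0r Zvec0 addr0.
split=> [i j| |]; first by rewrite !ord1 eqxx.
- by apply: mes_null_sub S0 => x [[_ _]]; rewrite t0.
- by apply: mes_null_sub S'0 => x [].
Qed.

Section main_case.
Variables (S S' : set 'rV[R]_d).
Hypothesis halpha : irrational_vec alpha.
Hypotheses (bS : bounded_set S) (bS' : bounded_set S').
Variables (E : set 'rV[R]_d) (c : nat).
Hypothesis E0 : mes E = 0%E.
Hypothesis bdS : boundary S `<=` E.
Hypothesis bdS' : boundary S' `<=` E.
Hypothesis excess_le : forall x, ~ E x -> forall n,
  `|excess alpha S S' n x| <= c%:Z.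
Let G := orbit_free alpha E.

Let GD x v : G x -> Zalpha_Zd alpha v -> G (x + v).
Proof. exact: orbit_free_shift. Qed.

Let GnE x : G x -> ~ E x.
Proof.
by move=> Gx; rewrite -[x]addr0; apply: Gx; exists 0, 0; rewrite scale0r Zvec0 addr0.
Qed.

Definition same_fibres L y x := forall k : 'I_L,
  fibre S (y + k%:R *: alpha) = fibre S (x + k%:R *: alpha) /\
  fibre S' (y + k%:R *: alpha) = fibre S' (x + k%:R *: alpha).

Lemma near_same_fibres L x : G x -> \forall y \near x, same_fibres L y x.
Proof.
move=> Gx.
have nb B : boundary B `<=` E -> forall k m,
    ~ boundary B (x + k%:R *: alpha + Zvec R m).
  by move=> BE k m /BE; rewrite -addrA; apply: Gx; exists k%:Z, m.
apply: (@filter_forall _ _ (fun (k : 'I_L) y =>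
  fibre S (y + k%:R *: alpha) = fibre S (x + k%:R *: alpha) /\
  fibre S' (y + k%:R *: alpha) = fibre S' (x + k%:R *: alpha)) (nbhs x)) => k.
have near_fibre_k B : bounded_set B -> boundary B `<=` E ->
    \forall y \near x, fibre B (y + k%:R *: alpha) = fibre B (x + k%:R *: alpha).
  move=> bB BE.
  apply: (near_translate (P := fun y => fibre B y = fibre B (x + k%:R *: alpha))).
  by apply: near_fibre => // m; exact: nb.
by apply: filterS2 (near_fibre_k _ bS bdS) (near_fibre_k _ bS' bdS') => y.
Qed.

Lemma same_fibres_visits L y x n : same_fibres L y x -> (n <= L)%N ->
  visits alpha S n y = visits alpha S n x /\
  visits alpha S' n y = visits alpha S' n x.
Proof.
move=> H nL; split; apply: eq_bigr => k _; rewrite /fibre_card;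
  by have [e e'] := H (widen_ord nL k); rewrite ?e ?e'.
Qed.

Lemma same_fibres_excess L y x n : same_fibres L y x -> (n <= L)%N ->
  excess alpha S S' n y = excess alpha S S' n x.
Proof. by move=> H nL; have [e e'] := same_fibres_visits H nL; rewrite /excess e e'. Qed.

Lemma same_fibres_queue L W y x : same_fibres L y x -> (W <= L)%N ->
  queue alpha S S' W y = queue alpha S S' W x.
Proof.
move=> H WL; apply: eq_bigr => n _.
by have [|-> ->//] := same_fibres_visits (n := n) H; rewrite (leq_trans _ WL)// -ltnS.
Qed.

Lemma same_fibres_served L W y x n m : same_fibres L y x -> (W <= L)%N -> (n < L)%N ->
  served alpha S S' (queue alpha S S' W) y n m <->
  served alpha S S' (queue alpha S S' W) x n m.
Proof.
move=> H WL nL; rewrite /served /fibre_rank (same_fibres_queue H WL).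
have [_ ->] := same_fibres_visits H (ltnW nL).
have [_ /= ->] := H (Ordinal nL).
by have [/= ] := H (Ordinal (leq_ltn_trans (leq0n n) nL)); rewrite !scale0r !addr0 => ->.
Qed.

(** The excess is integral, and bounded on G, so its largest oscillation is
    attained. *)
Lemma max_excess_range x0 : G x0 -> exists D : int,
  (forall x, G x -> forall n1 n2,
    excess alpha S S' n1 x - excess alpha S S' n2 x <= D) /\
  exists x n1 n2, G x /\ excess alpha S S' n1 x - excess alpha S S' n2 x = D.
Proof.
move=> Gx0.
pose P (n : nat) := `[< exists x n1 n2, G x /\
  excess alpha S S' n1 x - excess alpha S S' n2 x = n%:Z >].
have Pub n : P n -> (n <= c + c)%N.
  move=> /asboolP[x [n1 [n2 [Gx e]]]].
  have := excess_le (GnE Gx) n1; have := excess_le (GnE Gx) n2.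
  move: (excess _ _ _ _ _) (excess _ _ _ _ _) e; lia.
have P0 : exists n, P n.
  by exists 0%N; apply/asboolP; exists x0, 0%N, 0%N; rewrite subrr.
case: (ex_maxnP P0 Pub) => D /asboolP[x [n1 [n2 [Gx e]]]] Dmax.
exists D%:Z; split; last by exists x, n1, n2.
move=> y Gy k1 k2; rewrite leNgt; apply/negP => lt.
have : (absz (excess alpha S S' k1 y - excess alpha S S' k2 y) <= D)%N.
  apply: Dmax; apply/asboolP; exists y, k1, k2; split=> //.
  by rewrite gez0_abs// (le_trans _ (ltW lt)).
move: lt; lia.
Qed.

(** Any window longer than the time to reach the place where the oscillation D is
    seen, plus the time to see it, will do. *)
Lemma queue_exists x0 : G x0 -> exists W K,
  [/\ forall x, G x -> (queue alpha S S' W x <= K)%N &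
      forall x, G x -> (queue alpha S S' W x + fibre_card S x =
        queue alpha S S' W (x + alpha) + fibre_card S' x)%N].
Proof.
move=> /max_excess_range[D [rangeD [x1 [n1 [n2 [Gx1 e1]]]]]].
pose L := maxn n1 n2.
have near1 := near_same_fibres L Gx1.
have [N hitU] : exists N : nat, forall x, exists k m, (k < N)%N /\
    (same_fibres L ^~ x1)° (x + k%:R *: alpha + Zvec R m).
  apply: hitting_time => //; first exact: open_interior.
  by exists x1; exact: near1.
pose W := (N + L).+1.
have attained x : G x -> exists n1 n2, [/\ (n1 < W)%N, (n2 < W)%N &
    excess alpha S S' n1 x - excess alpha S S' n2 x = D].
  move=> _; have [k [m [kN /interior_subset H]]] := hitU x.
  exists (k + n1)%N, (k + n2)%N; split; rewrite /W /L; try lia.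
  rewrite !excessD opprD addrACA subrr add0r.
  rewrite -(excess_shift _ bS bS' _ _ m) -(excess_shift _ bS bS' n2 _ m).
  by rewrite !(same_fibres_excess H) ?leq_maxl ?leq_maxr.
exists W, (absz D); split=> x Gx.
  have := queue_le rangeD attained Gx; lia.
exact: (queue_balance GD rangeD attained Gx).
Qed.

Lemma visits_unbounded K : S'° !=set0 -> exists N, forall x,
  (K <= visits alpha S' N x)%N.
Proof.
move=> S'int; have [N hitS'] := hitting_time halpha (@open_interior _ S') S'int.
have once x : (1 <= visits alpha S' N x)%N.
  have [k [m [kN /interior_subset S'y]]] := hitS' x.
  rewrite (leq_trans _ (leq_visits alpha S' x kN))// visitsS.
  rewrite (leq_trans _ (leq_addl _ _))//.
  by rewrite (leq_trans _ (rank_lt_card (height alpha)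
    (fibre_finite (x + k%:R *: alpha) bS') (S'y : fibre S' _ m))).
exists (K * N)%N; elim: K => [//|K IH] x.
by rewrite mulSn visitsD; have := leq_add (once x) (IH (x + N%:R *: alpha)).
Qed.

Lemma equidecomposable_of_excess x0 : G x0 -> S'° !=set0 ->
  riemann_equidecomposable (Zalpha_Zd alpha) S S'.
Proof.
move=> Gx0 S'int; have [W [K [qK qbal]]] := queue_exists Gx0.
have [N KN] := visits_unbounded K S'int.
pose q := queue alpha S S' W.
have q_visits x y : G x -> (q x <= visits alpha S' N y)%N.
  by move=> Gx; exact: leq_trans (qK x Gx) (KN y).
have q_shift x m : q (x + Zvec R m) = q x by exact: queue_shift.
have [M SM] := bounded_coord bS; have [M' SM'] := bounded_coord bS'.
pose L := (M + N * Num.bound `|alpha| + M')%N.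
pose I : finType := ('I_N.+1 * {ffun 'I_d -> 'I_L.*2.+1})%type.
pose disp (i : I) : 'rV[R]_d := (i.1 : nat)%:R *: alpha + Zvec R (zbox i.2).
pose serves s (i : I) := `[< served alpha S S' q s i.1 (zbox i.2) >].
pose choose s : I := odflt (ord0, [ffun=> ord0]) [pick i | serves s i].
(* S, S' and the waiting times are bounded, so the lattice part of a
     displacement lies in a fixed box. *)
have box_served s n m : S s -> (n < N.+1)%N -> served alpha S S' q s n m ->
    exists2 i : I, serves s i & (i.1 : nat) = n /\ zbox i.2 = m.
  move=> Ss nN sv.
  have [|f fm] := @zbox_exists _ L m.
    apply: (lattice_step_bounded (x := s + n%:R *: alpha) _ (SM' _ sv.1) erefl).
    move=> i; rewrite !mxE (le_trans (ler_normD _ _))// natrD lerD ?SM//.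
    rewrite normrM normr_nat natrM ler_pM// ?ler_nat//.
    by rewrite (le_trans (le_mxnorm alpha i))// ltW// archi_boundP.
  by exists (Ordinal nN, f); rewrite //= /serves fm; exact/asboolP.
have choose_served s : G s -> S s -> serves s (choose s).
  move=> Gs Ss; rewrite /choose; case: pickP => [//|none].
  have [n [m [nN sv]]] := served_exists halpha bS bS' GD qbal q_visits Gs Ss.
  by have [j] := box_served _ _ _ Ss nN sv; rewrite none.
have near_choose x : G x -> \forall y \near x, choose y = choose x.
  move=> Gx; apply: filterS (near_same_fibres (W + N.+1) Gx) => y H.
  congr odflt; apply: eq_pick => i; apply: asbool_equiv_eq.
  by apply: (same_fibres_served _ H); [exact: leq_addr | apply: ltn_addl].
pose P (j : 'I_#|I|) := [set s | S s /\ choose s = enum_val j].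
have inP s : S s -> P (enum_rank (choose s)) s by move=> Ss; split; rewrite ?enum_rankK.
have transP j y : translate (disp (enum_val j)) (P j) y ->
    exists s, [/\ S s, choose s = enum_val j & y = s + disp (choose s)].
  by move=> [s [Ss cs] <-]; exists s; rewrite cs.
have G0 : mes (~` G) = 0%E by exact: mes_orbit_free.
have dispZ i : Zalpha_Zd alpha (disp i) by exists (i.1 : nat)%:Z, (zbox i.2).
have G_back s i : G (s + disp i) -> G s.
  move=> H; rewrite -[s](addrK (disp i)); apply: GD => //.
  by have [n [m e]] := dispZ i; exists (- n), (- m); rewrite e opprD ZvecN mulrNz scaleNr.
exists #|I|, P, (fun j => disp (enum_val j)); split=> //.
- move=> j; split; first by apply: (sub_boundedr _ bS) => B SB x [] /SB.
  apply: mes_null_sub G0; apply: boundary_subC => x Gx.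
  have bx : ~ boundary S x by move=> /bdS; exact: GnE.
  apply: filterS2 (near_not_boundary bx) (near_choose x Gx) => y SySx cyx.
  by rewrite /P /= SySx cyx.
- apply/seteqP; split=> [x [j _ []]//|x Sx].
  by exists (enum_rank (choose x)) => //; exact: inP.
- move=> i j _ _ [x [[_ ci] [_ cj]]]; apply: enum_val_inj.
  by rewrite -ci -cj.
split.
- move=> i j ij; apply: mes_null_sub G0 => y.
  move=> [/transP[s1 [S1 c1 e1]] /transP[s2 [S2 c2 e2]]] Gy.
  have G1 : G s1 by apply: (G_back _ (choose s1)); rewrite -e1.
  have G2 : G s2 by apply: (G_back _ (choose s2)); rewrite -e2.
  have /asboolP sv1 := choose_served _ G1 S1.
  have /asboolP sv2 := choose_served _ G2 S2.
  have s12 : s1 = s2.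
    apply: (served_inj halpha bS bS' GD q_shift qbal G1 G2 S1 S2 sv1 sv2).
    by rewrite -!addrA -/(disp _) -e1 -/(disp _) -e2.
  by move/eqP: ij; apply; apply: enum_val_inj; rewrite -c1 -c2 s12.
- apply: mes_null_sub G0 => y [[j _ /transP[s [Ss cs e]]] nS'] Gy; apply: nS'.
  have Gs : G s by apply: (G_back _ (choose s)); rewrite -e.
  have /asboolP[] := choose_served _ Gs Ss.
  by rewrite /fibre /= -addrA -/(disp _) -e.
- apply: mes_null_sub G0 => y [S'y nP] Gy; apply: nP.
  have [s [n [m [nN Ss sv e]]]] :=
    served_surj halpha bS bS' GD q_shift qbal q_visits Gy S'y.
  have Gs : G s.
    have [i _ [ni mi]] := box_served _ _ _ Ss nN sv.
    by apply: (G_back _ i); rewrite /disp ni mi addrA -e.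
  have /asboolP sv' := choose_served _ Gs Ss.
  have [en em] := served_uniq halpha bS' sv sv'.
  exists (enum_rank (choose s)) => //; exists s; first exact: inP.
  by rewrite enum_rankK e en em addrA.
Qed.

End main_case.
End assembly.

Theorem theorem2 (R : realType) (d : nat) (hd : (1 <= d)%N)
    (alpha : 'rV[R]_d) (halpha : irrational_vec alpha)
    (S S' : set 'rV[R]_d)
    (hS : riemann_measurable S) (hS' : riemann_measurable S')
    (bS : bounded_remainder_set alpha S)
    (bS' : bounded_remainder_set alpha S')
    (hmes : mes S = mes S') :
  riemann_equidecomposable (Zalpha_Zd alpha) S S'.
Proof.
have [bdS S0] := hS; have [bdS' S'0] := hS'.
have [E1 [C1 [E10 C10 H1]]] := brs_visits bS.
have [E2 [C2 [E20 C20 H2]]] := brs_visits bS'.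
pose E := (boundary S `|` boundary S') `|` (E1 `|` E2).
have E0 : mes E = 0%E by do 2!apply: mes_null_setU.
have [[x0 Gx0]|noG] := pselect (orbit_free alpha E !=set0); last first.
  (* The complement of G is null, so here every set is. *)
  have all0 (A : set 'rV[R]_d) : mes A = 0%E.
    apply: mes_null_sub (mes_orbit_free alpha E0) => x _ Gx.
    by apply: noG; exists x.
  exact: null_equidecomposable.
have [S'int|noint] := pselect (S'° !=set0); last first.
  have mS' : mes S' = 0%E.
    apply: mes_null_sub S'0 => x S'x; split; first exact: subset_closure.
    by move=> intx; apply: noint; exists x.
  by apply: null_equidecomposable => //; rewrite hmes.
apply: (@equidecomposable_of_excess _ _ alpha S S' halpha bdS bdS' E
  (Num.bound (C1 + C2)) E0 _ _ _ x0 Gx0 S'int).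
- by move=> x bx; left; left.
- by move=> x bx; left; right.
move=> x nEx n.
have h1 : ~ E1 x by move=> ?; apply: nEx; right; left.
have h2 : ~ E2 x by move=> ?; apply: nEx; right; right.
have := archi_boundP (addr_ge0 C10 C20); have := H1 x h1 n; have := H2 x h2 n.
rewrite hmes -(ler_int R) intr_norm /excess rmorphB /= -!pmulrn.
rewrite !ler_norml; lra.
Qed.
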